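(* There is an absolute constant $C>0$ such that the following holds. Let $q$ be a power of an odd prime, $d\ge 2$, and let $A,B\subset\mathbb{F}_q^d$ with $A\cap B=\emptyset$ and $|A|^2|B|\ge C q^{d+2}$. Then there exist $x,y\in A$ and $z\in B$ such that $(x,y,z)$ forms a right angle.
   Context: For $u,v\in\mathbb{F}_q^d$, $u\cdot v=\sum_{i=1}^d u_iv_i$. An ordered triple $(x,y,z)\in(\mathbb{F}_q^d)^3$ forms a right angle if $x,y,z$ are pairwise distinct and $(x-y)\cdot(z-y)=0$. *)

(* Defs.v *)
From HB Require Import structures.
From mathcomp Require Import all_boot all_order all_algebra all_field.
Set Implicit Arguments. Unset Strict Implicit. Unset Printing Implicit Defensive.
Import Order.TTheory GRing.Theory Num.Theory.
Local Open Scope ring_scope.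

Definition dotv (F : fieldType) (d : nat) (u v : 'rV[F]_d) : F :=
  \sum_(i < d) u 0 i * v 0 i.

Definition right_angle (F : fieldType) (d : nat) (x y z : 'rV[F]_d) : Prop :=
  [/\ x != y, y != z, x != z & dotv (x - y) (z - y) = 0].

(* Main.v *)
(** Count the points of [A] on the hyperplanes [{x | v . x = c}], [v] and [c]
  ranging over all vectors and scalars: the counts have mean [|A| / q] and total
  squared deviation at most [|A| q ^ d].  If there is no right angle, then for
  [y] in [A] and [z] in [B] the hyperplane through [y] with normal [z - y] meets
  [A] in [y] alone.  Hence [(y, z)] can be recovered from
  [(z - y, (z - y) . y)], and there are [|A| |B|] pairs [(v, c)] with count [1].
  If [|A| >= 2 q], each of them deviates from the mean by at least
  [|A| / (2 q)], so [|A| ^ 2 |B| <= 4 q ^ (d + 2)]; if [|A| < 2 q], this bound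
  follows from [|B| <= q ^ d]. *)
Require Import Defs.
From HB Require Import structures.
From mathcomp Require Import all_boot all_order all_algebra all_field.
From mathcomp Require Import ring lra.
Import Order.TTheory GRing.Theory Num.Theory.
Local Open Scope ring_scope.

Section DotProduct.

Context {F : fieldType} {d : nat}.
Implicit Types u v w : 'rV[F]_d.

Lemma dotvC u v : dotv u v = dotv v u.
Proof. by apply: eq_bigr => i _; rewrite mulrC. Qed.

Lemma dotvBr u v w : dotv u (v - w) = dotv u v - dotv u w.
Proof.
rewrite /dotv -sumrB; apply: eq_bigr => i _.
by rewrite !mxE mulrBr.
Qed.

Lemma dotvDZl (a : F) u v w : dotv (u + a *: v) w = dotv u w + a * dotv v w.
Proof.
rewrite /dotv mulr_sumr -big_split; apply: eq_bigr => i _.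
by rewrite !mxE /= mulrDl mulrA.
Qed.

Lemma dotv_delta i w : dotv (delta_mx 0 i) w = w 0 i.
Proof.
rewrite /dotv (bigD1 i) //= big1 => [|j /negbTE ji].
  by rewrite mxE !eqxx mul1r addr0.
by rewrite mxE ji andbF mul0r.
Qed.

End DotProduct.

(** Choose [e] with [dotv e w = 1], a multiple of a basis vector on whose coordinate [w] is nonzero.
    Every vector is then uniquely [u + c *: e] with [u] orthogonal to [w], where [c] is its product
    with [w]. *)
Lemma card_orthogonal (F : finFieldType) (d : nat) (w : 'rV[F]_d) :
  w != 0 -> (#|F| * #|[set v | dotv v w == 0%R]| = #|F| ^ d)%N.
Proof.
case/rV0Pn=> i wi0; pose e : 'rV[F]_d := (w 0 i)^-1 *: delta_mx 0 i.
have dote u c : dotv (u + c *: e) w = dotv u w + c.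
  by rewrite scalerA dotvDZl dotv_delta -mulrA mulVf ?mulr1.
transitivity #|'rV[F]_d|; last by rewrite card_mx mul1n.
rewrite -cardsT mulnC -cardsX.
have inj : {in setX [set v | dotv v w == 0] [set: F] &,
              injective (fun p => p.1 + p.2 *: e)}.
  move=> [u c] [u' c']; rewrite !inE /= !andbT => /eqP u0 /eqP u'0 eq_uc.
  have := congr1 (fun v => dotv v w) eq_uc; rewrite /= !dote u0 u'0 !add0r => eq_c.
  by move: eq_uc; rewrite eq_c => /addIr ->.
rewrite -(card_in_imset inj) -cardsT; congr #|pred_of_set _|.
apply/setP=> v; rewrite inE; apply/imsetP.
exists (v - dotv v w *: e, dotv v w); last by rewrite /= subrK.
by rewrite !inE /= -scaleNr dote subrr eqxx.
Qed.

Section HyperplaneCounts.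

Context {F : finFieldType} {d : nat}.
Variable A : {set 'rV[F]_d}.

Local Notation q := (#|F|%:R : rat).
Local Notation a := (#|A|%:R : rat).

Definition hyperplane_count (p : 'rV[F]_d * F) : rat :=
  #|[set x in A | dotv p.1 x == p.2]|%:R.

Lemma hyperplane_countE p :
  hyperplane_count p = \sum_(x in A) (dotv p.1 x == p.2)%:R.
Proof.
rewrite /hyperplane_count -sum1_card natr_sum big_mkcond [RHS]big_mkcond /=.
by apply: eq_bigr => x _; rewrite inE; case: (x \in A); case: eqP.
Qed.

Lemma sum_scalar_eq (b : F) (G : F -> rat) :
  \sum_c (b == c)%:R * G c = G b.
Proof.
rewrite (bigD1 b) //= eqxx mul1r big1 ?addr0 // => c.
by rewrite eq_sym => /negbTE ->; rewrite mul0r.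
Qed.

Lemma sum_hyperplane_count : \sum_p hyperplane_count p = a * q ^+ d.
Proof.
rewrite (eq_bigr _ (fun p _ => hyperplane_countE p)) exchange_big /=.
rewrite (eq_bigr (fun=> q ^+ d)); first by rewrite sumr_const mulr_natl.
move=> x _; rewrite -(pair_bigA _ (fun v c => (dotv v x == c)%:R)) /=.
rewrite (eq_bigr (fun=> 1)) => [|v _].
  by rewrite sumr_const card_mx mul1n natrX.
rewrite -[RHS](sum_scalar_eq (dotv v x) (fun=> 1)).
by apply: eq_bigr => c _; rewrite mulr1.
Qed.

(** The factor [q] keeps the exponent [d - 1] of the off-diagonal terms out of the statement. *)
Lemma sum_hyperplane_count_sqr :
  q * \sum_p hyperplane_count p ^+ 2 <= a * q ^+ d.+1 + a ^+ 2 * q ^+ d.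
Proof.
(* The square counts pairs [x], [y] on a common hyperplane; for fixed [v] some [c] serves both
   exactly when [v] is orthogonal to [y - x]. *)
have -> : \sum_p hyperplane_count p ^+ 2 =
    \sum_(x in A) \sum_(y in A) #|[set v | dotv v (y - x) == 0]|%:R.
  under eq_bigr => p _.
    rewrite expr2 hyperplane_countE mulr_suml.
    under eq_bigr do rewrite mulr_sumr.
    over.
  rewrite exchange_big; apply: eq_bigr => x _.
  rewrite exchange_big; apply: eq_bigr => y _ /=.
  rewrite -(pair_bigA _ (fun v c => (dotv v x == c)%:R * (dotv v y == c)%:R)) /=.
  rewrite -sum1_card natr_sum [RHS]big_mkcond; apply: eq_bigr => v _.
  rewrite (sum_scalar_eq _ (fun c => (dotv v y == c)%:R)) inE dotvBr subr_eq0.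
  by case: eqP.
rewrite mulr_sumr.
apply: (@le_trans _ _ (\sum_(x in A) (q ^+ d.+1 + a * q ^+ d))); last first.
  by rewrite sumr_const -[leLHS]mulr_natl mulrDr mulrA -expr2.
(* The diagonal term [y = x] admits every [v]; each other [y] gives exactly [q ^+ d] after
   multiplication by [q]. *)
apply: ler_sum => x xA; rewrite mulr_sumr (bigD1 x) //= lerD //.
  rewrite exprS ler_wpM2l // -natrX ler_nat.
  by rewrite -[d in leqRHS]mul1n -card_mx max_card.
apply: (@le_trans _ _ (\sum_(y in A | y != x) q ^+ d)).
  apply: ler_sum => y /andP[_ yx].
  by rewrite -natrM card_orthogonal ?natrX // subr_eq0.
rewrite sumr_const -[leLHS]mulr_natl ler_wpM2r ?exprn_ge0 // ler_nat.
by apply/subset_leq_card/subsetP => y /andP[].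
Qed.

(** Deviations are scaled by [q] to avoid division. On expanding the square, the terms in
    [a ^+ 2 * q ^+ d.+1] have coefficients 1, -2 and 1 and cancel. *)
Lemma hyperplane_count_variance :
  \sum_p (q * hyperplane_count p - a) ^+ 2 <= a * q ^+ d.+2.
Proof.
have q0 : 0 <= q by [].
have -> : \sum_p (q * hyperplane_count p - a) ^+ 2 =
    q * (q * \sum_p hyperplane_count p ^+ 2)
    - 2 * q * a * \sum_p hyperplane_count p + a ^+ 2 * q ^+ d.+1.
  have -> : a ^+ 2 * q ^+ d.+1 = \sum_(p : 'rV[F]_d * F) a ^+ 2.
    rewrite sumr_const card_prod card_mx mul1n -[RHS]mulr_natr.
    by rewrite natrM natrX (exprSr q).
  rewrite mulrA !mulr_sumr -sumrB -big_split /=.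
  by apply: eq_bigr => p _; ring.
rewrite sum_hyperplane_count.
have := ler_wpM2l q0 sum_hyperplane_count_sqr.
rewrite !exprS; lra.
Qed.

Lemma card_no_right_angle (B : {set 'rV[F]_d}) :
  (forall x y z, x \in A -> y \in A -> z \in B ->
     dotv (z - y) x = dotv (z - y) y -> x = y) ->
  a * #|B|%:R * (q - a) ^+ 2 <= a * q ^+ d.+2.
Proof.
move=> noangle; apply: le_trans hyperplane_count_variance.
pose h (p : 'rV[F]_d * 'rV[F]_d) := (p.2 - p.1, dotv (p.2 - p.1) p.1).
have h_inj : {in setX A B &, injective h}.
  move=> [y z] [y' z'] /setXP[/= yA zB] /setXP[/= y'A z'B].
  rewrite /h /= => -[eq_v eq_c]; have eq_y : y = y'.
    (* Equal images put [y] on the hyperplane through [y'] with normal [z' - y']. *)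
    by apply: (noangle y y' z') => //; rewrite -eq_v eq_c eq_v.
  by move: eq_v; rewrite eq_y => /addIr ->.
have count1 p : p \in h @: setX A B -> hyperplane_count p = 1.
  case/imsetP=> -[y z] /setXP[/= yA zB] ->; rewrite /hyperplane_count /=.
  rewrite (_ : [set x in A | _] = [set y]) ?cards1 //.
  apply/setP=> x; rewrite !inE; apply/andP/eqP => [[xA /eqP]|->] //.
  exact: noangle.
rewrite -natrM -cardsX -(card_in_imset h_inj).
rewrite (bigID (mem (h @: setX A B))) /= -[leLHS]addr0 lerD //.
  rewrite (eq_bigr (fun=> (q - a) ^+ 2)) => [|p /count1 ->].
    by rewrite sumr_const mulr_natl.
  by rewrite mulr1.
by apply: sumr_ge0 => p _; exact: sqr_ge0.
Qed.

End HyperplaneCounts.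

Lemma sqr_mul_le_of_variance (R : realFieldType) (a b q : R) (d : nat) :
  0 <= a -> 0 <= b -> 0 < q -> b <= q ^+ d ->
  a * b * (q - a) ^+ 2 <= a * q ^+ d.+2 -> a ^+ 2 * b <= 4 * q ^+ d.+2.
Proof.
move=> a0 b0 q0 b_le variance.
have [a_small|a_large] := ltP a (2 * q).
  have a2 : a ^+ 2 <= 4 * q ^+ 2 by nra.
  have := ler_pM (sqr_ge0 a) b0 a2 b_le.
  by rewrite -(mulrA 4) -exprD add2n.
have a_gt0 : 0 < a by lra.
(* Here [a >= 2 * q], hence [a - q >= a / 2]. *)
have half : a ^+ 2 <= 4 * (q - a) ^+ 2 by nra.
have : b * (q - a) ^+ 2 <= q ^+ d.+2 by rewrite -(ler_pM2l a_gt0) mulrA.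
have := ler_wpM2r b0 half; lra.
Qed.

Theorem theorem2p2 :
  exists C : rat, 0 < C /\
    forall (F : finFieldType) (d : nat), odd #|F| -> (2 <= d)%N ->
    forall A B : {set 'rV[F]_d},
      [disjoint A & B] ->
      C * (#|F| ^ (d + 2))%:R <= (#|A| ^ 2 * #|B|)%:R ->
      exists x y z, [/\ x \in A, y \in A, z \in B & right_angle x y z].
Proof.
(* Without a right angle the bound has constant 4, so any constant above 4 gives a contradiction. *)
exists 5; split=> // F d _ _ A B disAB; rewrite addn2 natrX natrM natrX => large.
have [|noangle] := boolP [exists x in A, exists y in A, exists z in B,
    (x != y) && (dotv (z - y) x == dotv (z - y) y)].
  case/exists_inP=> x xA /exists_inP[y yA] /exists_inP[z zB].
  case/andP=> xy /eqP eq_xy; exists x, y, z; split=> //.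
  split=> //; last by rewrite dotvC dotvBr eq_xy subrr.
    (* Disjointness of [A] and [B] separates [z] from [y], and likewise from [x]. *)
    by apply: contraTneq zB => <-; rewrite (disjointFr disAB yA).
  by apply: contraTneq zB => <-; rewrite (disjointFr disAB xA).
suff: #|A|%:R ^+ 2 * #|B|%:R <= 4 * #|F|%:R ^+ d.+2 :> rat.
  have : 0 < #|F|%:R ^+ d.+2 :> rat.
    by rewrite exprn_gt0 // ltr0n; apply/card_gt0P; exists 0.
  lra.
have : #|A|%:R * #|B|%:R * (#|F|%:R - #|A|%:R) ^+ 2
    <= #|A|%:R * #|F|%:R ^+ d.+2 :> rat.
  apply: card_no_right_angle => x y z xA yA zB eq_xy.
  apply: contraNeq noangle => xy.
  apply/exists_inP; exists x => //; apply/exists_inP; exists y => //.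
  by apply/exists_inP; exists z; rewrite // xy eq_xy eqxx.
apply: sqr_mul_le_of_variance => //.
  by rewrite ltr0n; apply/card_gt0P; exists 0.
by rewrite -natrX ler_nat -[d in leqRHS]mul1n -card_mx max_card.
Qed.
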